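(* A graph $G$ is word-representable if and only if it admits a semi-transitive orientation. Moreover, each non-complete word-representable graph $G$ on $n$ vertices is $2(n-\kappa)$-word-representable, where $\kappa$ is the size of the maximum clique in $G$.
   Context: Graphs are finite, simple and undirected (and have at least one vertex). Two distinct letters $x,y$ alternate in a word $W$ if the word obtained from $W$ by deleting all letters other than $x$ and $y$ contains neither $xx$ nor $yy$ as a factor (two consecutive letters). A word $W$ represents a graph $G=(V,E)$ if the set of letters occurring in $W$ is $V$ (every vertex occurs at least once) and, for all distinct $x,y\in V$, $xy\in E$ if and only if $x$ and $y$ alternate in $W$. $G$ is word-representable if some word represents it. A word is $k$-uniform if each of its letters occurs in it exactly $k$ times. $G$ is $k$-word-representable if some $k$-uniform word represents it. An orientation of $G$ (a choice of direction for each edge) is semi-transitive if it is acyclic (has no directed cycle) and for every directed path $v_1\rightarrow v_2\rightarrow\cdots\rightarrow v_k$ either there is no arc $v_1\rightarrow v_k$, or there are arcs $v_i\rightarrow v_j$ for all $1\le i<j\le k$. *)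

(* Defs.v *)
From mathcomp Require Import all_boot.

Set Implicit Arguments.
Unset Strict Implicit.
Unset Printing Implicit Defensive.

(* A simple graph is a symmetric irreflexive relation e on a finType T of
   vertices; a word is a sequence of vertices. *)

Section Graphs.
Variables (T : finType) (e : rel T).

Definition is_clique (A : {set T}) : bool :=
  [forall x in A, forall y in A, (x != y) ==> e x y].

Definition complete : bool := is_clique [set: T].

Definition clique_number : nat := \max_(A : {set T} | is_clique A) #|A|.

End Graphs.

Section Words.
Variables (T : finType) (e : rel T).

Definition alternate (x y : T) (W : seq T) : bool :=
  let Wxy := [seq z <- W | (z == x) || (z == y)] in
  ~~ infix [:: x; x] Wxy && ~~ infix [:: y; y] Wxy.

Definition represents (W : seq T) : Prop :=
  (forall x : T, x \in W) /\
  (forall x y : T, x != y -> (e x y <-> alternate x y W)).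

Definition word_representable : Prop := exists W : seq T, represents W.

Definition uniform (k : nat) (W : seq T) : Prop :=
  forall x : T, count_mem x W = k.

Definition k_word_representable (k : nat) : Prop :=
  exists W : seq T, uniform k W /\ represents W.

End Words.

Section Orientations.
Variables (T : finType) (e : rel T).

(* [a x y] is the arc x -> y; each edge receives exactly one direction. *)
Definition orientation (a : rel T) : Prop :=
  (forall x y : T, e x y <-> a x y \/ a y x) /\
  (forall x y : T, ~ (a x y /\ a y x)).

Definition acyclic (a : rel T) : Prop :=
  forall c : seq T, ucycle a c -> c = [::].

(* The directed path v_1 -> ... -> v_k is the sequence x :: p, so v_1 = x and
   v_k = last x p. *)
Definition semi_transitive (a : rel T) : Prop :=
  acyclic a /\
  (forall (x : T) (p : seq T), uniq (x :: p) -> path a x p ->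
     ~ a x (last x p) \/ pairwise a (x :: p)).

Definition semi_transitively_orientable : Prop :=
  exists a : rel T, orientation a /\ semi_transitive a.

End Orientations.

(* Main.v *)
Require Import Defs.
From mathcomp Require Import all_boot.

(** Write [c_z P] for the number of letters [z] in a prefix [P] of a word.  Two
    letters [x], [y] alternate in a word with [x] coming first exactly when
    [c_y P <= c_x P <= c_y P + 1] for every prefix [P]; this relation is called
    [leads x y] below, and [alternateE] says that alternation is [leads] in one
    of the two directions.

    From words to orientations, orient an edge from the letter that leads to
    the letter that follows.  Along a directed path the numbers [c_z P] can only
    decrease, so on a directed cycle they would all be equal, which is absurd
    once [P] is a prefix ending at a first occurrence.  If moreover there is an
    arc from the first vertex [v] to the last vertex [w] of a path, then
    [c_v P <= c_w P + 1], so all the numbers [c_z P] on the path lie within one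
    unit of each other and decrease: any two vertices of the path are joined by
    an arc.

    From orientations to words, it suffices to construct for every vertex [v] a
    2-uniform word [W_v] whose restriction to the ends of any arc [x -> y] is
    [xyxy], and in which [v] alternates with no vertex that is not adjacent to
    it.  Indeed such words may be concatenated: edges keep alternating, and a
    non-edge is destroyed as soon as [W_v] is a factor for one of its ends [v].
    It is thus enough to let [v] range over a vertex cover of the complement
    graph, such as the complement of a maximum clique, which gives the bound
    [2 (n - kappa)].  Relative to [v], let [I] and [O] be the sets of in- and
    out-neighbours, [A] and [B] those of the other ancestors and descendants, and
    [Q] the set of the remaining vertices.  Then
    [[
        W_v = A I Q A v O I v B Q O B
    ]]
    where each block is listed in a fixed topological order.  The restriction
    of [W_v] to [v] and a vertex of [A], [B] or [Q] is [aavv], [vvbb] or [qvvq],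
    so it destroys the non-edges at [v].  The arcs that [W_v] would not respect
    do not exist, either by definition of the blocks and acyclicity or, for
    [A -> O], [A -> B], [I -> A], [I -> B] and [B -> O], by semi-transitivity
    ([arc_block_ok]). *)

Set Implicit Arguments.
Unset Strict Implicit.
Unset Printing Implicit Defensive.

(** * Alternation through prefix counts *)

Section Leading.
Variable T : eqType.
Implicit Types (x y z : T) (W : seq T).

Definition leads x y W : bool :=
  [forall n : 'I_(size W).+1,
    count_mem y (take n W) <= count_mem x (take n W)
                           <= (count_mem y (take n W)).+1].

Lemma leadsP x y W :
  reflect (forall n, count_mem y (take n W) <= count_mem x (take n W)
                       <= (count_mem y (take n W)).+1)
          (leads x y W).
Proof.
apply: (iffP forallP) => [H n|H n]; last exact: H.
have [le_nW|lt_Wn] := leqP n (size W).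
  by have := H (Ordinal (le_nW : n < (size W).+1)).
have := H ord_max; rewrite /= take_size.
by rewrite take_oversize // ltnW.
Qed.

Lemma leads_nil x y : leads x y [::].
Proof. by apply/leadsP => n. Qed.

Lemma leads_cons_first x y W : x != y -> leads x y (x :: W) = leads y x W.
Proof.
move=> xy; apply/leadsP/leadsP => H n.
  have := H n.+1; rewrite /= eqxx (negbTE xy) add0n add1n ltnS.
  by rewrite andbC.
case: n => [|n] //=; rewrite eqxx (negbTE xy) add0n add1n ltnS.
by rewrite andbC H.
Qed.

Lemma leads_cons_second x y W : x != y -> leads x y (y :: W) = false.
Proof.
move=> xy; apply/leadsP => /(_ 1) /=.
by rewrite take0 /= eqxx eq_sym (negbTE xy).
Qed.

Lemma leads_cons_other x y z W :
  z != x -> z != y -> leads x y (z :: W) = leads x y W.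
Proof.
move=> zx zy; apply/leadsP/leadsP => H n.
  by have := H n.+1; rewrite /= (negbTE zx) (negbTE zy).
by case: n => [|n] //=; rewrite (negbTE zx) (negbTE zy); apply: H.
Qed.

Lemma leads_filter x y W :
  x != y -> leads x y [seq z <- W | (z == x) || (z == y)] = leads x y W.
Proof.
elim: W x y => // z W IH x y xy /=.
have [->|zx] /= := eqVneq z x.
  rewrite !leads_cons_first // -IH 1?eq_sym //.
  by congr leads; apply: eq_filter => u; rewrite orbC.
have [->|zy] /= := eqVneq z y; first by rewrite !leads_cons_second.
by rewrite IH // leads_cons_other.
Qed.

(** Two letters leading each other have equal counts in all prefixes; the
    prefix that ends at the first occurrence of one of them forbids this. *)
Lemma leads_antisym x y W : x != y -> x \in W -> leads x y W -> ~~ leads y x W.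
Proof.
move=> xy; elim: W => // z W IH.
have [->|zx] := eqVneq z x.
  by move=> _ _; rewrite leads_cons_second // eq_sym.
rewrite inE eq_sym (negbTE zx) /= => xW.
have [->|zy] := eqVneq z y; first by rewrite leads_cons_second.
by rewrite !leads_cons_other //; apply: IH.
Qed.

End Leading.

Section Alternation.
Variable T : finType.
Implicit Types (x y z : T) (W : seq T).

Lemma alternateC x y W : alternate x y W = alternate y x W.
Proof.
rewrite /alternate (@eq_filter _ _ (fun z => (z == y) || (z == x))) 1?andbC //.
by move=> z; rewrite orbC.
Qed.

(** After a letter [x], alternation with [y] means that [y] comes next, if any
    of the two does; this turns the symmetric [alternate] into the oriented
    [leads] and makes the induction on the word go through. *)
Lemma alternate_cons x y W : x != y -> alternate x y (x :: W) = leads y x W.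
Proof.
elim: W x y => [|z W IH] x y xy.
  by rewrite leads_nil /alternate /= eqxx /= !andbF.
rewrite /alternate /=.
have yx : y != x by rewrite eq_sym.
have [->|zx] /= := eqVneq z x; rewrite eqxx /=.
  by rewrite leads_cons_second //= prefix0s !eqxx.
have [->|zy] /= := eqVneq z y.
  rewrite leads_cons_first // -IH // alternateC /alternate /=.
  by rewrite (negbTE xy) (negbTE yx) !eqxx /= (negbTE xy) eqxx.
rewrite leads_cons_other //.
by rewrite -IH // /alternate /= !eqxx /= eqxx.
Qed.

Lemma alternateE x y W :
  x != y -> alternate x y W = leads x y W || leads y x W.
Proof.
move=> xy; have yx : y != x by rewrite eq_sym.
elim: W => [|z W IH]; first by rewrite !leads_nil.
have [->|zx] := eqVneq z x.
  by rewrite alternate_cons // leads_cons_first // leads_cons_second ?orbF.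
have [->|zy] := eqVneq z y.
  by rewrite alternateC alternate_cons // leads_cons_second ?leads_cons_first.
by rewrite !leads_cons_other // -IH /alternate /= (negbTE zx) (negbTE zy).
Qed.

Lemma alternate_factor x y U V W :
  alternate x y (U ++ V ++ W) -> alternate x y V.
Proof.
have sub u : infix [:: u; u] [seq z <- V | (z == x) || (z == y)] ->
    infix [:: u; u] [seq z <- U ++ V ++ W | (z == x) || (z == y)].
  by move/infix_trans; apply; rewrite !filter_cat infix_infix.
by rewrite /alternate => /andP[nx ny]; apply/andP; split;
  [apply: contra nx | apply: contra ny]; apply: sub.
Qed.

End Alternation.

(** * From words to semi-transitive orientations *)

Section WordToOrientation.
Variables (T : finType) (e : rel T) (W : seq T).
Hypothesis e_irr : irreflexive e.
Hypothesis W_rep : represents e W.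

Definition word_arc : rel T := [rel x y | (x != y) && leads x y W].

Lemma word_arc_path_count x p n z :
  path word_arc x p -> z \in x :: p ->
  count_mem (last x p) (take n W) <= count_mem z (take n W)
                                  <= count_mem x (take n W).
Proof.
elim: p x z => [|y p IH] x z /=; first by rewrite inE => _ /eqP->; rewrite leqnn.
move=> /andP[/andP[_ /leadsP/(_ n)/andP[cyx _]] py].
have hd := mem_head y p.
rewrite inE => /predU1P[->|zp].
  by have /andP[l1 _] := IH y y py hd; rewrite leqnn andbT (leq_trans l1).
by have /andP[-> l2] := IH y z py zp; rewrite (leq_trans l2).
Qed.

Lemma word_arc_acyclic : acyclic word_arc.
Proof.
case=> // x c /andP[]; rewrite /cycle => cyc _; exfalso.
case: c cyc => [|y c] /=; first by rewrite /word_arc /= eqxx.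
move=> /andP[/andP[xy ld] py].
have : leads y x W.
  apply/leadsP => n; have /leadsP/(_ n)/andP[l1 l2] := ld.
  have := word_arc_path_count n py (mem_head _ _).
  rewrite last_rcons => /andP[l3 _].
  by rewrite l3 leqW.
by apply/negP; apply: leads_antisym => //; case: W_rep.
Qed.

(** Counts decrease along the path and the closing arc bounds the total
    decrease by one. *)
Lemma word_arc_shortcut x p :
  uniq (x :: p) -> path word_arc x p -> word_arc x (last x p) ->
  pairwise word_arc (x :: p).
Proof.
move=> U P /andP[_ /leadsP ld].
have bound z : z \in x :: p -> forall n,
    count_mem x (take n W) <= (count_mem z (take n W)).+1.
  move=> zp n; have /andP[l _] := word_arc_path_count n P zp.
  by have /andP[_ l'] := ld n; rewrite (leq_trans l') // ltnS.
have below z : z \in x :: p -> forall n,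
    count_mem z (take n W) <= count_mem x (take n W).
  by move=> zp n; have /andP[] := word_arc_path_count n P zp.
have sub_all q u : path word_arc u q ->
    uniq (u :: q) -> {subset u :: q <= x :: p} -> pairwise word_arc (u :: q).
  elim: q u => [|w q IH] u // Pu Uu sub.
  have /andP[_ Pw] : word_arc u w && path word_arc w q := Pu.
  have /andP[nu Uw] : (u \notin w :: q) && uniq (w :: q) := Uu.
  rewrite pairwise_cons IH //; last first.
    by move=> z zq; apply: sub; rewrite inE zq orbT.
  rewrite andbT; apply/allP => z zq; apply/andP; split.
    by apply: contraNneq nu => ->.
  apply/leadsP => n.
  have /andP[_ ->] /= := word_arc_path_count n Pu (mem_behead (s := u :: w :: q) zq).
  apply: leq_trans (below u (sub u (mem_head _ _)) n) _.
  by apply: bound; apply: sub; rewrite inE zq orbT.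
exact: sub_all.
Qed.

Lemma word_arc_orientation : orientation e word_arc.
Proof.
have [inW rep] := W_rep.
split=> x y; last first.
  by move=> [/andP[xy l1] /andP[_]]; apply/negP; apply: leads_antisym.
have [->|xy] := eqVneq x y.
  by rewrite e_irr /word_arc /= eqxx; split=> // -[].
have := rep x y xy; rewrite alternateE // => repxy.
rewrite /word_arc /= (eq_sym y) xy /=.
by split=> [/repxy/orP|/orP/repxy].
Qed.

End WordToOrientation.

Lemma semi_transitive_of_word (T : finType) (e : rel T) :
  irreflexive e -> word_representable e -> semi_transitively_orientable e.
Proof.
move=> e_irr [W W_rep]; exists (word_arc W).
split; first exact: word_arc_orientation.
split; first exact: word_arc_acyclic W_rep.
move=> x p U P; case: (boolP (word_arc W x (last x p))) => arc; last by left.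
by right; apply: word_arc_shortcut.
Qed.

(** * Topological order of an acyclic orientation *)

Section TopologicalOrder.
Variables (T : finType) (a : rel T).
Hypothesis a_acyc : acyclic a.

(** Along an arc the set of ancestors grows strictly, so sorting by its
    cardinal is a topological sort. *)
Definition ancestor_count (x : T) : nat := #|[pred u | connect a u x]|.

Lemma acyclic_connect x y : a x y -> ~~ connect a y x.
Proof.
move=> axy; apply/negP => /connectP[p py lastx].
case/shortenP: py lastx => q pq uq _ lastx.
suff: ucycle a (y :: q) by move/a_acyc.
by rewrite /ucycle uq andbT /= rcons_path pq -lastx.
Qed.

Lemma ancestor_count_arc x y : a x y -> ancestor_count x < ancestor_count y.
Proof.
move=> axy; apply: proper_card; apply/properP; split.
  apply/subsetP => u; rewrite !inE => ux.
  exact: connect_trans ux (connect1 axy).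
by exists y; rewrite !inE ?connect0 // acyclic_connect.
Qed.

Lemma acyclic_path_uniq x p : path a x p -> uniq (x :: p).
Proof.
move=> P; apply: (@map_uniq _ _ ancestor_count).
apply: (sorted_uniq ltn_trans ltnn); rewrite sorted_map.
by apply: sub_path P => u w; apply: ancestor_count_arc.
Qed.

Lemma acyclic_connect_antisym x y : connect a x y -> connect a y x -> x = y.
Proof.
move=> /connectP[[|z p] //= /andP[axz pz] ->] yx.
have := acyclic_connect axz; rewrite (connect_trans _ yx) //.
by apply/connectP; exists p.
Qed.

Definition topo : seq T :=
  sort (fun x y => ancestor_count x <= ancestor_count y) (enum T).

Lemma mem_topo x : x \in topo.
Proof. by rewrite mem_sort mem_enum. Qed.

Lemma topo_uniq : uniq topo.
Proof. by rewrite sort_uniq enum_uniq. Qed.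

Lemma topo_pair x y : x != y ->
  [seq z <- topo | (z == x) || (z == y)] = [:: x; y] \/
  [seq z <- topo | (z == x) || (z == y)] = [:: y; x].
Proof.
move=> xy; set F := filter _ _.
have : perm_eq F [:: x; y].
  apply: uniq_perm; rewrite ?filter_uniq ?topo_uniq //= ?inE ?xy //.
  by move=> z; rewrite mem_filter mem_topo andbT !inE.
case: F => [|u [|w [|? ?]]] perm_F; have //= := perm_size perm_F.
have := perm_mem perm_F u; have := perm_mem perm_F w.
have := perm_uniq perm_F; rewrite /= !inE !eqxx xy orbT /= andbT => uw.
move=> /esym/orP[]/eqP wE /esym/orP[]/eqP uE; rewrite wE uE ?eqxx // in uw *;
by [left|right].
Qed.

Lemma topo_arc x y : a x y ->
  [seq z <- topo | (z == x) || (z == y)] = [:: x; y].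
Proof.
move=> axy; have lt_xy := ancestor_count_arc axy.
have xy : x != y by apply: contraTneq lt_xy => ->; rewrite ltnn.
case: (topo_pair xy) => // F.
have : sorted (fun x y => ancestor_count x <= ancestor_count y)
         [seq z <- topo | (z == x) || (z == y)].
  apply: sorted_filter; first by move=> ? ? ?; apply: leq_trans.
  by apply: sort_sorted => u w; apply: leq_total.
by rewrite F /= andbT leqNgt lt_xy.
Qed.

End TopologicalOrder.

(** * The word attached to a vertex *)

Inductive block := Anc | In | Incomp | Self | Out | Desc.

Definition same_block (b c : block) : bool :=
  match b, c with
  | Anc, Anc | In, In | Incomp, Incomp | Self, Self | Out, Out | Desc, Desc =>
      true
  | _, _ => false
  end.

Definition block_pattern : seq block :=
  [:: Anc; In; Incomp; Anc; Self; Out; In; Self; Desc; Incomp; Out; Desc].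

(** An arc from block [b] to block [c] is harmless when the restriction of
    [block_pattern] to [b] and [c] is [bcbc], and also inside a block other
    than the singleton [Self], since both copies of the block follow the same
    topological order. *)
Definition block_ok (b c : block) : bool :=
  match b, c with
  | Anc, (Anc | In | Incomp) | In, (In | Incomp | Self | Out)
  | Incomp, (Incomp | Out | Desc) | Self, Out | Out, (Out | Desc)
  | Desc, Desc => true
  | _, _ => false
  end.

Section LocalWord.
Variables (T : finType) (e a : rel T).
Hypothesis a_or : orientation e a.
Hypothesis a_semi : semi_transitive a.

Let a_acyc : acyclic a := proj1 a_semi.

(** Semi-transitivity in the form in which it is used: the vertex [z] lies on a
    directed path that the arc [x -> y] short-cuts. *)
Lemma shortcut_middle x y z :
  a x y -> connect a x z -> connect a z y -> z != x -> z != y ->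
  a x z /\ a z y.
Proof.
move=> axy /connectP[p px zE] /connectP[q qz yE] zx zy.
have P : path a x (p ++ q) by rewrite cat_path px -zE.
have L : last x (p ++ q) = y by rewrite last_cat -zE.
have [/(_ _)//|] := (proj2 a_semi) _ _ (acyclic_path_uniq a_acyc P) P.
  by rewrite L.
rewrite -cat_cons pairwise_cat => /and3P[/allrelP pq pw _].
have zp : z \in p.
  by have := mem_last x p; rewrite -zE inE (negbTE zx).
have yq : y \in q.
  by have := mem_last z q; rewrite -yE inE eq_sym (negbTE zy).
split; last by apply: pq; rewrite // inE zp orbT.
by move: pw; rewrite pairwise_cons => /andP[/allP/(_ z zp)].
Qed.

Section AtVertex.
Variable v : T.

Definition block_of (u : T) : block :=
  if u == v then Self
  else if a u v then In
  else if a v u then Out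
  else if connect a u v then Anc
  else if connect a v u then Desc
  else Incomp.

Definition local_word : seq T :=
  flatten [seq [seq z <- topo a | same_block (block_of z) b]
              | b <- block_pattern].

(** Arcs such as [Out -> In] would close a directed cycle, an arc leaving
    [Incomp] towards [Anc], [In] or [v], or entering it from [Out], [Desc] or
    [v], would make its end comparable to [v]; arcs [Anc -> v] and [v -> Desc] are
    excluded by definition of the blocks.  The other forbidden pairs form
    shortcuts of a path containing [v], against semi-transitivity. *)
Lemma arc_block_ok x y : a x y -> block_ok (block_of x) (block_of y).
Proof.
move=> axy.
have ayx : a y x = false.
  by apply: contraNF (acyclic_connect a_acyc axy); apply: connect1.
have xNy : x != y by apply: contraFneq ayx => xy; rewrite -xy {2}xy.
rewrite /block_of.
have [xv|xv] := eqVneq x v; have [yv|yv] := eqVneq y v.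
- by rewrite xv yv eqxx in xNy.
- by rewrite -xv axy ayx.
- by rewrite -yv axy.
have cxy := connect1 axy.
have asym u : u != v -> connect a u v ==> ~~ connect a v u.
  move=> uv; apply/implyP => cuv; apply: contra uv => cvu.
  by apply/eqP; apply: acyclic_connect_antisym cuv cvu.
have arc u w : a u w ==> connect a u w by apply/implyP => /connect1.
(* The three ways in which the arc can be part of a shortcut that has [v] on
   its path: [v] lies between [x] and [y], after [y], or before [x]. *)
have between : connect a x v && connect a v y ==> a x v && a v y.
  apply/implyP => /andP[c d]; apply/andP.
  by apply: shortcut_middle axy c d _ _; rewrite eq_sym.
have after : a x v && connect a y v ==> a y v.
  apply/implyP => /andP[axv c].
  have yx : y != x by rewrite eq_sym.
  by have [] := shortcut_middle axv cxy c yx yv.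
have before : a v y && connect a v x ==> a v x.
  apply/implyP => /andP[avy c].
  by have [] := shortcut_middle avy c cxy xv xNy.
have up : connect a y v ==> connect a x v.
  by apply/implyP; apply: connect_trans.
have down : connect a v x ==> connect a v y.
  by apply/implyP => c; apply: connect_trans c cxy.
move: (asym x xv) (asym y yv) (arc x v) (arc v x) (arc y v) (arc v y).
move: between after before up down.
case: (a x v); case: (a v x); case: (a y v); case: (a v y);
by case: (connect a x v); case: (connect a v x);
   case: (connect a y v); case: (connect a v y).
Qed.

(** Once the list [topo a] is filtered down to one or two letters, the restriction
    of the word is a computation on the blocks of these letters. *)
Lemma filter_local_word (p : pred T) :
  filter p local_word =
  flatten [seq [seq z <- filter p (topo a) | same_block (block_of z) b]
              | b <- block_pattern].
Proof.
rewrite /local_word filter_flatten -map_comp; congr flatten.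
by apply: eq_map => b /=; rewrite -!filter_predI; apply: eq_filter => z /=;
  rewrite andbC.
Qed.

Lemma local_word_arc x y : a x y ->
  [seq z <- local_word | (z == x) || (z == y)] = [:: x; y; x; y].
Proof.
move=> axy; rewrite filter_local_word topo_arc //=.
by case: block_of (arc_block_ok axy); case: block_of.
Qed.

(** The restriction to [v] and [x] is [xxvv], [xvvx] or [vvxx] according to the
    block of [x], in whatever way [topo] orders the two vertices. *)
Lemma local_word_nonadjacent x :
  x != v -> ~~ e x v -> ~~ alternate x v local_word.
Proof.
move=> xv nexv; rewrite /alternate filter_local_word.
have : block_of v = Self by rewrite /block_of eqxx.
have nxv : a x v = false by apply: contraNF nexv => ?; apply/(proj1 a_or); left.
have nvx : a v x = false by apply: contraNF nexv => ?; apply/(proj1 a_or); right.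
have : match block_of x with In | Self | Out => false | _ => true end.
  by rewrite /block_of (negbTE xv) nxv nvx; case: ifP => // _; case: ifP.
have vx : v != x by rewrite eq_sym.
case: (topo_pair a xv) => -> /=; case: block_of => // _ -> /=;
by rewrite !eqxx ?(negbTE xv) ?(negbTE vx).
Qed.

Lemma local_word_uniform : uniform 2 local_word.
Proof.
move=> x; rewrite -size_filter filter_local_word.
rewrite (filter_pred1_uniq (topo_uniq a) (mem_topo a x)) /=.
by case: block_of.
Qed.

End AtVertex.

Definition cover_word (C : {set T}) : seq T :=
  flatten [seq local_word v | v in C].

Lemma cover_word_uniform (C : {set T}) : uniform (2 * #|C|) (cover_word C).
Proof.
move=> x; rewrite /cover_word cardE /image_mem.
elim: (enum C) => //= v s IH.
by rewrite count_cat local_word_uniform IH mulnS.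
Qed.

(** Restricted to the ends of an arc [x -> y], the word is a power of [xyxy]. *)
Lemma cover_word_arc (C : {set T}) x y : a x y -> leads x y (cover_word C).
Proof.
move=> axy; have xy : x != y.
  by apply/eqP => xy; apply: (proj2 a_or x y); rewrite -xy in axy *.
have yx : y != x by rewrite eq_sym.
rewrite -leads_filter // /cover_word /image_mem.
elim: (enum C) => [|v s IH] /=; first exact: leads_nil.
by rewrite filter_cat local_word_arc //= !leads_cons_first.
Qed.

Lemma cover_word_nonadjacent (C : {set T}) x v :
  v \in C -> x != v -> ~~ e x v -> ~~ alternate x v (cover_word C).
Proof.
move=> vC xv /(local_word_nonadjacent xv); apply: contra.
rewrite /cover_word /image_mem.
have : v \in enum C by rewrite mem_enum.
case/splitPr => s1 s2; rewrite map_cat flatten_cat /=.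
exact: alternate_factor.
Qed.

End LocalWord.

(** * Vertex covers of the complement graph *)

(** [C] has to be nonempty for every vertex to occur in the word. *)
Lemma representable_of_cover (T : finType) (e : rel T) (C : {set T}) :
  symmetric e -> 0 < #|C| ->
  (forall x y, x != y -> ~~ e x y -> (x \in C) || (y \in C)) ->
  semi_transitively_orientable e -> k_word_representable e (2 * #|C|).
Proof.
move=> e_sym C_gt0 cover [a [a_or a_semi]].
exists (cover_word a C); split; first exact: cover_word_uniform.
split=> [x|x y xy].
  by rewrite -has_pred1 has_count cover_word_uniform muln_gt0.
split.
  rewrite alternateE // => /(proj1 a_or)[] arc.
    by rewrite (cover_word_arc a_or a_semi C arc).
  by rewrite (cover_word_arc a_or a_semi C arc) orbT.
apply: contraTT => nexy; case/orP: (cover x y xy nexy) => inC; last first.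
  exact: (cover_word_nonadjacent a_or).
rewrite alternateC; apply: (cover_word_nonadjacent a_or) => //.
  by rewrite eq_sym.
by rewrite e_sym.
Qed.

Lemma maximum_clique (T : finType) (e : rel T) :
  exists2 K : {set T}, is_clique e K & #|K| = clique_number e.
Proof.
have : 0 < #|[pred A : {set T} | is_clique e A]|.
  apply/card_gt0P; exists set0; rewrite inE.
  by apply/forall_inP => x; rewrite inE.
by case/(eq_bigmax_cond (fun A : {set T} => #|A|)) => K KC Kmax;
  exists K; rewrite // -Kmax.
Qed.

Theorem theorem3 (T : finType) (e : rel T)
    (e_sym : symmetric e) (e_irr : irreflexive e) (T_gt0 : 0 < #|T|) :
  (word_representable e <-> semi_transitively_orientable e) /\
  (word_representable e -> ~~ complete e ->
     k_word_representable e (2 * (#|T| - clique_number e))).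
Proof.
split; first split; first exact: semi_transitive_of_word.
  move=> or_e; have [] := @representable_of_cover T e [set: T] e_sym.
  - by rewrite cardsT.
  - by move=> x y _ _; rewrite inE.
  - exact: or_e.
  by move=> W [_ W_rep]; exists W.
move=> /(semi_transitive_of_word e_irr) or_e ncomp.
have [K K_clique <-] := maximum_clique e.
have -> : #|T| - #|K| = #|~: K| by rewrite -(cardsC K) addKn.
apply: representable_of_cover or_e => // [|x y xy nexy].
  rewrite card_gt0; apply: contra ncomp => /eqP CK0.
  by rewrite /complete -setC0 -CK0 setCK.
rewrite !inE -negb_and; apply: contra nexy => /andP[xK yK].
by have /forall_inP/(_ x xK)/forall_inP/(_ y yK)/implyP := K_clique; apply.
Qed.
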